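(* Let $E$ be a countably infinite-dimensional vector space over a countable field $F$ with distinguished basis $(e_n)_{n\in\mathbb{N}}$. Then $\diamondsuit(\mathrm{bb}^\infty(E^2),=^\infty)$ implies $\mathfrak{a}_{\mathrm{vec},F}=\aleph_1$.
   Context: For nonzero $v\in E$, $\mathrm{supp}(v)$ is the set of $n$ with nonzero coefficient of $e_n$ in $v$; $v<w$ means $\max\mathrm{supp}(v)<\min\mathrm{supp}(w)$. A block sequence is a sequence $(x_n)_{n\in\mathbb{N}}$ of nonzero vectors with $x_n<x_{n+1}$ for all $n$; a block subspace is the linear span of a block sequence. Two subspaces are almost disjoint if their intersection is finite-dimensional; a family of infinite-dimensional subspaces is almost disjoint if its members are pairwise almost disjoint, and maximal almost disjoint (mad) if it is not properly contained in another such family. $\mathfrak{a}_{\mathrm{vec},F}$ is the minimum cardinality of an infinite mad family of block subspaces of $E$. $\mathrm{bb}^\infty(E^2)$ is the Polish space of sequences $(x_n^0,x_n^1)_{n\in\mathbb{N}}$ of pairs of nonzero vectors of $E$ with $x_n^0<x_n^1<x_{n+1}^0<x_{n+1}^1$ for all $n$. For $X,Y\in\mathrm{bb}^\infty(E^2)$, $X=^\infty Y$ means $X(n)=Y(n)$ for infinitely many $n$. The principle $\diamondsuit(\mathrm{bb}^\infty(E^2),=^\infty)$ states: for every Borel $\Phi:2^{<\omega_1}\to\mathrm{bb}^\infty(E^2)$ (i.e. $\Phi\upharpoonright 2^\delta$ is Borel for every $\delta<\omega_1$) there is $g:\omega_1\to\mathrm{bb}^\infty(E^2)$ such that for every $f:\omega_1\to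 2$ the set $\{\delta<\omega_1:\Phi(f\upharpoonright\delta)=^\infty g(\delta)\}$ is stationary. *)

(* Defs.v *)
From HB Require Import structures.
From mathcomp Require Import all_boot all_order all_algebra.
From mathcomp Require Import all_classical all_reals all_analysis.
From mathcomp Require wochoice.

Set Implicit Arguments.
Unset Strict Implicit.
Unset Printing Implicit Defensive.

Import Order.TTheory GRing.Theory.

Local Open Scope classical_set_scope.
Local Open Scope card_scope.
Local Open Scope ring_scope.

Section LinearAlgebra.
Variables (F : fieldType) (E : lmodType F).
Implicit Types (A B V : set E) (v w : E).

Definition lspan A : set E :=
  [set v | exists (N : nat) (c : 'I_N -> F) (u : 'I_N -> E),
     (forall i, A (u i)) /\ v = \sum_(i < N) c i *: u i].

Definition lsubspace V : Prop := GRing.submod_closed (mem V).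

Definition finite_dim V : Prop := exists2 B, finite_set B & V = lspan B.

Definition is_basis (e : nat -> E) : Prop :=
  lspan (range e) = setT /\
  forall (N : nat) (a : nat -> F), \sum_(i < N) a i *: e i = 0 ->
    forall i, (i < N)%N -> a i = 0.

Definition almost_disjoint_family (S : set (set E)) : Prop :=
  (forall V, S V -> lsubspace V /\ ~ finite_dim V) /\
  (forall U V, S U -> S V -> U <> V -> finite_dim (U `&` V)).

Definition mad (S : set (set E)) : Prop :=
  almost_disjoint_family S /\
  forall S', almost_disjoint_family S' -> ~ (S `<` S').

End LinearAlgebra.

Section Blocks.
Variables (F : fieldType) (E : lmodType F) (e : nat -> E).
Implicit Types (v w : E).

Definition supp v : set nat :=
  [set n | exists (N : nat) (a : nat -> F),
     [/\ v = \sum_(i < N) a i *: e i, (n < N)%N & a n != 0]].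

(* [block_lt v w] fails if [v] or [w] is 0, whose support has no extrema. *)
Definition block_lt v w : Prop :=
  exists M m : nat,
    [/\ supp v M /\ (forall k, supp v k -> (k <= M)%N),
        supp w m /\ (forall k, supp w k -> (m <= k)%N) & (M < m)%N].

Definition block_sequence (x : nat -> E) : Prop :=
  forall n, x n != 0 /\ block_lt (x n) (x n.+1).

Definition block_subspace (V : set E) : Prop :=
  exists2 x, block_sequence x & V = lspan (range x).

Definition infinite_mad_block_family : set (set (set E)) :=
  [set S | [/\ mad S, infinite_set S & forall V, S V -> block_subspace V]].

Definition block_pairs : set {ptws nat -> discrete_topology (E * E)%type} :=
  [set X | forall n,
     [/\ (X n).1 != 0, (X n).2 != 0, block_lt (X n).1 (X n).2
       & block_lt (X n).2 (X n.+1).1]].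

(* Subspace topology inherited from the product of discrete copies of E * E. *)
Definition bb_infty : topologicalType := set_type block_pairs.

Definition eq_infinitely_often (X Y : bb_infty) : Prop :=
  infinite_set [set n | val X n = val Y n].

End Blocks.

(* The least cardinality of a member of P exists and equals that of K. *)
Definition min_card_eq {T U : Type} (P : set (set T)) (K : set U) : Prop :=
  (exists2 S, P S & S #= K) /\ (forall S, P S -> K #<= S).

Definition borel {T : topologicalType} : set (set T) := <<s @open T >>.

Definition borel_fun {T U : topologicalType} (f : T -> U) : Prop :=
  forall B : set U, borel B -> borel (f @^-1` B).

Section Omega1.
Context {d : Order.disp_t}.

(* This determines W up to a unique order isomorphism. *)
Definition is_omega1 (W : orderType d) : Prop :=
  [/\ wochoice.well_order (<=%O : rel W), ~ countable [set: W]
    & forall x : W, countable [set y : W | (y < x)%O]].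

Variable W : orderType d.

(* A set accumulating at x forces x to be a limit, once x is not the minimum. *)
Definition club (C : set W) : Prop :=
  (forall x, exists2 y, C y & (x < y)%O) /\
  (forall x, (exists y, (y < x)%O) ->
     (forall y, (y < x)%O -> exists2 z, C z & (y < z < x)%O) -> C x).

Definition stationary (S : set W) : Prop :=
  forall C, club C -> S `&` C !=set0.

Definition below (x : W) : set W := [set y | (y < x)%O].

Definition restr (f : W -> bool) (x : W) : {ptws below x -> bool} :=
  fun y => f (val y).

Definition diamond (B : topologicalType) (R : B -> B -> Prop) : Prop :=
  forall Phi : forall x : W, {ptws below x -> bool} -> B,
  (forall x, borel_fun (Phi x)) ->
  exists g : W -> B, forall f : W -> bool,
    stationary [set x | R (Phi x (@restr f x)) (g x)].

End Omega1.

(* Main.v *)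
(**
  Given a countable almost disjoint family (A_i) and a block subspace X almost
  disjoint from every A_i, one finds pairs (u_n, w_n) with w_n in X and w_n
  outside A_i + {v : v < u_n} for all i <= n. The first coordinate makes this
  a condition on the single pair (u_n, w_n): in any block sequence of pairs
  through (u_n, w_n), all earlier vectors lie below u_n. Hence, for an arbitrary
  block sequence g of pairs, the span of those second coordinates of g that
  satisfy the condition is almost disjoint from every A_i, and it meets X in an
  infinite-dimensional space as soon as g agrees infinitely often with the
  sequence chosen for X. The choice is Borel in codes for X and (A_i), so
  diamond supplies guesses g(x), x < omega_1, and the subspaces V_x built from
  them by recursion, added to a partition of the basis into infinitely many
  blocks, form a mad family. Conversely a countable infinite almost disjoint
  family (A_i) is not maximal: the same construction, taking w_n in A_(n+1),
  gives one more block subspace.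
*)
Require Import Defs.
From mathcomp Require Import all_boot all_order all_algebra.
From mathcomp Require Import all_classical all_reals all_analysis.

Set Implicit Arguments.
Unset Strict Implicit.
Unset Printing Implicit Defensive.

Import Order.TTheory GRing.Theory.

Local Open Scope classical_set_scope.
Local Open Scope card_scope.

(** * Linear algebra in a space with a basis *)

Section Subspaces.
Local Open Scope ring_scope.
Variables (F : fieldType) (E : lmodType F).
Implicit Types (A B U V : set E) (x u v w : E).

Lemma lsubspaceP V : lsubspace V <->
  V 0 /\ forall a u v, V u -> V v -> V (a *: u + v).
Proof.
split=> [[V0 Vl]|[V0 Vl]]; split.
- by move: V0; rewrite inE.
- move=> a u v Vu Vv; have := Vl a u v.
  by rewrite !inE /=; apply; rewrite ?inE.
- by rewrite inE.
- by move=> a u v; rewrite !inE; apply: Vl.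
Qed.

Lemma lsubspace0 V : lsubspace V -> V 0.
Proof. by move=> /lsubspaceP[]. Qed.

Lemma lsubspaceZD V a u v : lsubspace V -> V u -> V v -> V (a *: u + v).
Proof. by move=> /lsubspaceP[_]; apply. Qed.

Lemma lsubspaceZ V a u : lsubspace V -> V u -> V (a *: u).
Proof. by move=> sV Vu; rewrite -[_ *: _]addr0; apply: lsubspaceZD => //; exact: lsubspace0. Qed.

Lemma lsubspaceD V u v : lsubspace V -> V u -> V v -> V (u + v).
Proof. by move=> sV Vu Vv; rewrite -[u]scale1r; apply: lsubspaceZD. Qed.

Lemma lsubspaceB V u v : lsubspace V -> V u -> V v -> V (u - v).
Proof. by move=> sV Vu Vv; rewrite addrC -scaleN1r; apply: lsubspaceZD. Qed.

Lemma lsubspace_sum V N (u : 'I_N -> E) : lsubspace V ->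
  (forall i, V (u i)) -> V (\sum_(i < N) u i).
Proof.
move=> sV Vu; apply: (big_ind V) => //; first exact: lsubspace0.
by move=> x y; apply: lsubspaceD.
Qed.

Lemma lsubspaceI U V : lsubspace U -> lsubspace V -> lsubspace (U `&` V).
Proof.
move=> sU sV; apply/lsubspaceP; split; first by split; exact: lsubspace0.
by move=> a u v [? ?] [? ?]; split; apply: lsubspaceZD.
Qed.

Lemma lsubspace_set0 : lsubspace [set 0 : E].
Proof. by apply/lsubspaceP; split=> // a u v -> ->; rewrite /= scaler0 addr0. Qed.

Lemma sub_lspan A : A `<=` lspan A.
Proof.
move=> x Ax; exists 1%N, (fun=> 1), (fun=> x); split=> //.
by rewrite big_ord1 scale1r.
Qed.

Lemma lspan_sub A V : lsubspace V -> A `<=` V -> lspan A `<=` V.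
Proof.
move=> sV AV v [N [c [u [Au ->]]]]; apply: lsubspace_sum => // i.
by apply: lsubspaceZ => //; apply: AV.
Qed.

Lemma lspan_subspace A : lsubspace (lspan A).
Proof.
apply/lsubspaceP; split.
  by exists 0%N, (fun=> 0), (fun=> 0); split=> [[]//|]; rewrite big_ord0.
move=> a u v [N [c [x [Ax ->]]]] [M [b [y [Ay ->]]]].
exists (N + M)%N,
  (fun i : 'I_(N + M)%N => match fintype.split i with inl j => a * c j | inr j => b j end),
  (fun i : 'I_(N + M)%N => match fintype.split i with inl j => x j | inr j => y j end); split.
  by move=> i; case: splitP.
rewrite big_split_ord /= scaler_sumr; congr (_ + _); apply: eq_bigr => i _.
  by rewrite (unsplitK (inl _ i)) scalerA.
by rewrite (unsplitK (inr _ i)).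
Qed.

Lemma lspanS A B : A `<=` B -> lspan A `<=` lspan B.
Proof. by move=> AB; apply: lspan_sub (lspan_subspace _) (subset_trans AB (@sub_lspan B)). Qed.

Lemma comb_widen (x : nat -> E) (c : nat -> F) K K' : (K <= K')%N ->
  (forall j, (K <= j)%N -> c j = 0) ->
  \sum_(j < K') c j *: x j = \sum_(j < K) c j *: x j.
Proof.
move=> KK' c0; rewrite [RHS](big_ord_widen _ (fun j => c j *: x j) KK').
rewrite [RHS]big_mkcond /=; apply: eq_bigr => j _.
by case: ltnP => // /c0 ->; rewrite scale0r.
Qed.

(** [lspan] allows repeated vectors in any order. Indexing the coefficients by [nat], with zeros
    past K, merges the repetitions and lets two combinations be added once both are widened to the
    larger length. *)
Lemma lspan_range (x : nat -> E) v : lspan (range x) v ->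
  exists K (c : nat -> F), (forall j, (K <= j)%N -> c j = 0) /\
    v = \sum_(j < K) c j *: x j.
Proof.
apply: (@lspan_sub _ [set v | exists K (c : nat -> F),
  (forall j, (K <= j)%N -> c j = 0) /\ v = \sum_(j < K) c j *: x j]).
- apply/lsubspaceP; split.
    by exists 0%N, (fun=> 0); split=> //; rewrite big_ord0.
  move=> a u w [K [c [c0 ->]]] [M [b [b0 ->]]].
  exists (maxn K M), (fun j => a * c j + b j); split.
    move=> j; rewrite geq_max => /andP[Kj Mj].
    by rewrite c0// b0// mulr0 addr0.
  rewrite -(comb_widen _ (leq_maxl K M))// -(comb_widen _ (leq_maxr K M))//.
  rewrite scaler_sumr -big_split /=; apply: eq_bigr => j _.
  by rewrite scalerDl scalerA.
- move=> _ [i _ <-]; exists i.+1, (fun j => (j == i)%:R); split.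
    by move=> j ij; rewrite gtn_eqF.
  rewrite big_ord_recr /= eqxx scale1r big1 ?add0r// => j _.
  by rewrite ltn_eqF// scale0r.
Qed.

End Subspaces.

(** * Coordinates, heads and tails of vectors *)

Section Coordinates.
Local Open Scope ring_scope.
Variables (F : fieldType) (E : lmodType F) (e : nat -> E).
Hypothesis he : is_basis e.
Implicit Types (A B U V : set E) (x u v w : E).

Let bcoef_ex v : {c : nat -> F | exists K,
  (forall j, (K <= j)%N -> c j = 0) /\ v = \sum_(j < K) c j *: e j}.
Proof.
apply: cid; have [sp _] := he.
have /lspan_range[K [c H]] : lspan (range e) v by rewrite sp.
by exists c, K.
Qed.

Definition bcoef v : nat -> F := sval (bcoef_ex v).

Lemma bcoef_expand v : exists K,
  (forall j, (K <= j)%N -> bcoef v j = 0) /\ v = \sum_(j < K) bcoef v j *: e j.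
Proof. exact: (svalP (bcoef_ex v)). Qed.

Lemma bcoef_unique v (c : nat -> F) K : (forall j, (K <= j)%N -> c j = 0) ->
  v = \sum_(j < K) c j *: e j -> bcoef v = c.
Proof.
move=> c0 vc; have [M [d0 vd]] := bcoef_expand v.
have [_ li] := he; apply/funext => i.
have [|le_i] := ltnP i (maxn K M); last first.
  by move: le_i; rewrite geq_max => /andP[Ki Mi]; rewrite c0// d0.
move=> lt_i; apply/eqP; rewrite -subr_eq0; apply/eqP.
apply: (li _ (fun i => bcoef v i - c i)) lt_i.
under eq_bigr do rewrite scalerBl.
rewrite sumrB (comb_widen _ (leq_maxr K M))// (comb_widen _ (leq_maxl K M))//.
by rewrite -vc -vd subrr.
Qed.

Lemma bcoefZD a u v i : bcoef (a *: u + v) i = a * bcoef u i + bcoef v i.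
Proof.
have [K [c0 uE]] := bcoef_expand u; have [M [d0 vE]] := bcoef_expand v.
rewrite (@bcoef_unique _ (fun i => a * bcoef u i + bcoef v i) (maxn K M))//.
  move=> j; rewrite geq_max => /andP[Kj Mj].
  by rewrite c0// d0// mulr0 addr0.
under eq_bigr do rewrite scalerDl -scalerA.
rewrite big_split -scaler_sumr (comb_widen _ (leq_maxl K M))//.
by rewrite (comb_widen _ (leq_maxr K M))// -uE -vE.
Qed.

Lemma bcoef0 i : bcoef 0 i = 0.
Proof. by rewrite (@bcoef_unique 0 (fun=> 0) 0%N)// big_ord0. Qed.

Lemma bcoefZ a u i : bcoef (a *: u) i = a * bcoef u i.
Proof. by rewrite -[a *: u]addr0 bcoefZD bcoef0 addr0. Qed.

Lemma bcoefB u v i : bcoef (u - v) i = bcoef u i - bcoef v i.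
Proof. by rewrite addrC -scaleN1r bcoefZD mulN1r addrC. Qed.

Lemma bcoef_basis j i : bcoef (e j) i = (i == j)%:R.
Proof.
rewrite (@bcoef_unique _ (fun i => (i == j)%:R) j.+1)//.
  by move=> k jk; rewrite gtn_eqF.
rewrite big_ord_recr /= eqxx scale1r big1 ?add0r// => k _.
by rewrite ltn_eqF// scale0r.
Qed.

Lemma bcoef_eq0 v : (forall i, bcoef v i = 0) -> v = 0.
Proof.
move=> v0; have [K [_ ->]] := bcoef_expand v.
by rewrite big1// => i _; rewrite v0 scale0r.
Qed.

Lemma bcoef_inj u v : bcoef u = bcoef v -> u = v.
Proof.
move=> uv; apply/eqP; rewrite -subr_eq0; apply/eqP/bcoef_eq0 => i.
by rewrite bcoefB uv subrr.
Qed.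

Lemma basis_neq0 j : e j != 0.
Proof.
apply/eqP => ej0; have := bcoef_basis j j.
by rewrite ej0 bcoef0 eqxx => /esym/eqP; rewrite oner_eq0.
Qed.

Lemma basis_inj : injective e.
Proof.
move=> i j eij; apply/eqP; have := bcoef_basis j i.
by rewrite -eij bcoef_basis eqxx; case: eqP => // _ /eqP; rewrite oner_eq0.
Qed.

Lemma suppE v n : supp e v n <-> bcoef v n != 0.
Proof.
split=> [[N [a [vE nN an0]]]|cn0].
  rewrite (@bcoef_unique _ (fun i => if (i < N)%N then a i else 0) N) ?nN//.
    by move=> j; rewrite ltnNge => ->.
  by rewrite {1}vE; apply: eq_bigr => i _; rewrite ltn_ord.
have [K [c0 vE]] := bcoef_expand v; exists K, (bcoef v); split=> //.
by rewrite ltnNge; apply: contra cn0 => /c0 ->.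
Qed.

(** A vector is coded by the finite list of its coordinates below a chosen bound [c v]; the length
    of the list recovers the bound. *)
Lemma countable_space : countable [set: F] -> countable [set: E].
Proof.
move=> /countable_injP[h hinj].
pose c v := xget 0%N [set K | forall j, (K <= j)%N -> bcoef v j = 0].
have cP v j : (c v <= j)%N -> bcoef v j = 0.
  rewrite /c; case: xgetP => [K _ H /H//|]; have [K [H _]] := bcoef_expand v.
  by move=> /(_ K)/(_ H).
apply/countable_injP.
exists (fun v => pickle (mkseq (fun j => h (bcoef v j)) (c v))) => u v _ _.
move=> /(pcan_inj pickleK) uv.
have cuv : c u = c v by rewrite -(size_mkseq (h \o bcoef u) (c u)) uv size_mkseq.
apply: bcoef_inj; apply/funext => j; have [lt_j|le_j] := ltnP j (c u); last first.
  by rewrite !cP// -cuv.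
apply: hinj; rewrite ?inE//.
have := congr1 (fun s => nth 0%N s j) uv.
by rewrite !nth_mkseq// -cuv.
Qed.

Definition headv N : set E := [set v | forall i, (N <= i)%N -> bcoef v i = 0].
Definition tailv N : set E := [set v | forall i, (i < N)%N -> bcoef v i = 0].

(* Unlike [block_lt], the relation [precedes] allows zero vectors. *)
Definition precedes u v := exists N, headv N u /\ tailv N v.

(** For subspaces this is finite dimension, by [finite_dimP]; unlike [finite_dim], it passes to
    arbitrary subsets and applies to sets that are not subspaces. *)
Definition bounded V := exists N, V `<=` headv N.

Lemma head_subspace N : lsubspace (headv N).
Proof.
apply/lsubspaceP; split=> [i _|a u v Hu Hv i Ni]; first exact: bcoef0.
by rewrite bcoefZD Hu// Hv// mulr0 addr0.
Qed.

Lemma headS M N : (M <= N)%N -> headv M `<=` headv N.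
Proof. by move=> MN v Hv i Ni; apply/Hv/(leq_trans MN). Qed.

Lemma tailS M N : (M <= N)%N -> tailv N `<=` tailv M.
Proof. by move=> MN v Hv i iM; apply/Hv/(leq_trans iM). Qed.

Lemma exists_head v : exists N, headv N v.
Proof. by have [K [K0 _]] := bcoef_expand v; exists K. Qed.

Lemma head_tail0 N v : headv N v -> tailv N v -> v = 0.
Proof.
by move=> Hv Tv; apply: bcoef_eq0 => i; have [/Tv|/Hv] := ltnP i N.
Qed.

Lemma tail_head_lt M N v : v != 0 -> tailv M v -> headv N v -> (M < N)%N.
Proof.
move=> /eqP v0 Tv Hv; rewrite ltnNge; apply/negP => NM; apply: v0.
exact: head_tail0 Hv (tailS NM Tv).
Qed.

Lemma head_basis N j : (j < N)%N -> headv N (e j).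
Proof. by move=> jN i Ni; rewrite bcoef_basis gtn_eqF// (leq_trans jN). Qed.

Lemma tail_basis N j : (N <= j)%N -> tailv N (e j).
Proof. by move=> Nj i iN; rewrite bcoef_basis ltn_eqF// (leq_trans iN). Qed.

Lemma precedes_trans u v w : v != 0 ->
  precedes u v -> precedes v w -> precedes u w.
Proof.
move=> v0 [M [Hu Tv]] [N [Hv Tw]]; exists M; split=> //.
exact: tailS (ltnW (tail_head_lt v0 Tv Hv)) _ Tw.
Qed.

(** Each [precedes (u i) v] comes with its own cut. The least index M of the support of [v] is a cut
    that serves for all i at once. *)
Lemma precedes_sum N (c : 'I_N -> F) (u : 'I_N -> E) v :
  v != 0 -> (forall i, precedes (u i) v) -> precedes (\sum_(i < N) c i *: u i) v.
Proof.
move=> v0 uv.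
have [K HK] := exists_head v.
have [M [Tv nT]] : exists M, tailv M v /\ ~ tailv M.+1 v.
  have : exists M, `[<~ tailv M v>].
    exists K; apply/asboolP => T; move/eqP: v0; apply; exact: head_tail0 HK T.
  case/ex_minnP => -[/asboolP[]//|M /asboolP nT min].
  exists M; split=> //; apply: contrapT => /asboolP/min; rewrite ltnn//.
exists M; split=> //; apply: lsubspace_sum (head_subspace M) _ => i.
apply: lsubspaceZ (head_subspace M) _.
have [L [Hu Tv']] := uv i; apply: headS Hu.
rewrite leqNgt; apply/negP => ML; exact/nT/(tailS ML).
Qed.

Lemma block_ltP v w : block_lt e v w <-> [/\ v != 0, w != 0 & precedes v w].
Proof.
split=> [[M [m [[/suppE vM Mmax] [/suppE wm mmin] Mm]]]|[v0 w0 [N [Hv Tw]]]].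
  split.
  - by apply: contraNneq vM => ->; rewrite bcoef0.
  - by apply: contraNneq wm => ->; rewrite bcoef0.
  exists m; split=> i H; apply/eqP/negP => /negP/suppE.
    by move=> /Mmax; rewrite leqNgt (leq_trans Mm H).
  by move=> /mmin; rewrite leqNgt H.
have [M vM] : exists M, supp e v M.
  apply: contrapT => H; move/eqP: v0; apply; apply: bcoef_eq0 => i.
  by apply/eqP/negP => /negP vi; apply: H; exists i; apply/suppE.
have [m wm] : exists m, supp e w m.
  apply: contrapT => H; move/eqP: w0; apply; apply: bcoef_eq0 => i.
  by apply/eqP/negP => /negP vi; apply: H; exists i; apply/suppE.
have bv k : supp e v k -> (k < N)%N.
  by move=> /suppE; rewrite ltnNge; apply: contra => /Hv ->.
have bw k : supp e w k -> (N <= k)%N.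
  by move=> /suppE; rewrite leqNgt; apply: contra => /Tw ->.
have exv : exists k, `[<supp e v k>] by exists M; apply/asboolP.
have bdv k : `[<supp e v k>] -> (k <= N)%N by move=> /asboolP/bv/ltnW.
have exw : exists k, `[<supp e w k>] by exists m; apply/asboolP.
case: (ex_maxnP exv bdv) => i /asboolP vi imax.
case: (ex_minnP exw) => j /asboolP wj jmin.
exists i, j; split.
- by split=> // k vk; apply/imax/asboolP.
- by split=> // k wk; apply/jmin/asboolP.
- exact: leq_trans (bv _ vi) (bw _ wj).
Qed.

Lemma finite_dim_bounded V : finite_dim V -> bounded V.
Proof.
move=> [B finB ->].
suff [N HB] : bounded B by exists N; exact: lspan_sub (head_subspace N) HB.
move: finB => /finite_seqP[s ->].
have [K HK] := choice exists_head; exists (\max_(x <- s) K x)%N => x xs.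
by apply: headS (HK x); exact: leq_bigmax_seq.
Qed.

(** The hypothesis says that the first N coordinates determine a vector of V. In the induction, the
    vectors of V with vanishing coordinate N form a subspace covered by the case N, and at most one
    further generator [u] is missing. *)
Lemma finite_dim_tail N V : lsubspace V ->
  (forall v, V v -> tailv N v -> v = 0) -> finite_dim V.
Proof.
elim: N V => [|N IH] V sV VT.
  exists [set 0]; first exact: finite_set1.
  apply/seteqP; split=> [v Vv|].
    by apply: sub_lspan; rewrite (VT v Vv).
  by apply: lspan_sub => // _ ->; exact: lsubspace0.
pose V' := V `&` [set v | bcoef v N = 0].
have sV' : lsubspace V'.
  apply: lsubspaceI => //; apply/lsubspaceP; split=> [|a u v]; rewrite /= ?bcoef0//.
  by move=> u0 v0; rewrite bcoefZD u0 v0 mulr0 addr0.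
have [|B finB V'E] := IH V' sV'.
  move=> v [Vv vN0] Tv; apply: VT => // i; rewrite ltnS leq_eqVlt.
  by case/orP => [/eqP ->//|/Tv].
have [[u Vu uN]|nou] := EM (exists2 u, V u & bcoef u N != 0); last first.
  exists B => //; rewrite -V'E; apply/seteqP; split=> [v Vv|v []//].
  by split=> //=; apply/eqP/negP => /negP vN; apply: nou; exists v.
exists (B `|` [set u]); first by rewrite finite_setU; split=> //; exact: finite_set1.
apply/seteqP; split=> [v Vv|]; last first.
  apply: lspan_sub => // w [Bw|-> //].
  by have [] : V' w by rewrite V'E; exact: sub_lspan.
(* With this [a], coordinate N of [v - a *: u] vanishes, so the difference lies in [V']. *)
pose a := bcoef v N / bcoef u N.
rewrite -(subrK (a *: u) v) addrC; apply: lsubspaceZD (lspan_subspace _) _ _.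
  by apply: sub_lspan; right.
apply: (@lspanS _ _ B) => [w Bw|]; first by left.
rewrite -V'E; split; first by apply: lsubspaceB => //; exact: lsubspaceZ.
by rewrite /= bcoefB bcoefZ divfK// subrr.
Qed.

Lemma finite_dimP V : lsubspace V -> finite_dim V <-> bounded V.
Proof.
move=> sV; split; first exact: finite_dim_bounded.
move=> [N HV]; apply: (@finite_dim_tail N) => // v Vv.
exact/head_tail0/HV.
Qed.

Lemma unbounded_tail V N : lsubspace V -> ~ bounded V ->
  exists v, [/\ V v, tailv N v & v != 0].
Proof.
move=> sV nb; apply: contrapT => H; apply: nb; apply/finite_dimP => //.
apply: (@finite_dim_tail N) => // v Vv Tv; apply/eqP/negP => /negP v0.
by apply: H; exists v.
Qed.

Lemma tail_unbounded V : (forall N, exists v, [/\ V v, tailv N v & v != 0]) ->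
  ~ bounded V.
Proof.
move=> H [N HV]; have [v [/HV Hv Tv /eqP]] := H N; apply.
exact: head_tail0 Hv Tv.
Qed.

Lemma boundedS U V : U `<=` V -> bounded V -> bounded U.
Proof. by move=> UV [N VN]; exists N; exact: subset_trans VN. Qed.

Definition translates V H : set E := [set v | exists2 u, H u & V (v - u)].

(* [U `&` (V + <e_0, ..., e_M>)] exceeds [U `&` (V + <e_0, ..., e_(M-1)>)] by at
   most one dimension. *)
Lemma bounded_translates U V M : lsubspace U -> lsubspace V ->
  bounded (U `&` V) -> bounded (U `&` translates V (headv M)).
Proof.
move=> sU sV bUV; elim: M => [|M [N HN]].
  apply: boundedS bUV => v [Uv [u Hu Vvu]]; split=> //.
  by have := Vvu; rewrite (head_tail0 Hu)// subr0.
have [[u0 [Uu0 [h0 Hh0 Vu0] h0M]]|no] := EM (exists u0, [/\ U u0,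
    exists2 h, headv M.+1 h & V (u0 - h) /\ bcoef h M != 0 & True]); last first.
  exists N => v [Uv [h Hh Vvh]]; apply: HN; split=> //; exists h => // i.
  rewrite leq_eqVlt => /orP[/eqP <-|/Hh//].
  by apply/eqP/negP => /negP hM; apply: no; exists v; split=> //; exists h.
have {Vu0 h0M} [Vu0 h0M] := Vu0.
have [K HK] := exists_head u0; exists (maxn N K) => v [Uv [h Hh Vvh]].
(* Subtracting [a *: u0] cancels coordinate M of the head part, so the difference falls under the
   induction hypothesis. *)
pose a := bcoef h M / bcoef h0 M.
rewrite -(subrK (a *: u0) v); apply: lsubspaceD (head_subspace _) _ _; last first.
  by apply: lsubspaceZ (head_subspace _) _; exact: headS (leq_maxr _ _) _ HK.
apply: headS (leq_maxl _ _) _ _; apply: HN; split.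
  by apply: lsubspaceB => //; exact: lsubspaceZ.
exists (h - a *: h0).
  move=> i; rewrite leq_eqVlt => /orP[/eqP <-|Mi].
    by rewrite bcoefB bcoefZ divfK// subrr.
  by rewrite bcoefB bcoefZ Hh// Hh0// mulr0 subrr.
rewrite opprD addrACA -opprD -scalerBr.
by apply: lsubspaceB => //; exact: lsubspaceZ.
Qed.

Lemma block_subspace_subspace V : block_subspace e V -> lsubspace V.
Proof. by move=> [x _ ->]; exact: lspan_subspace. Qed.

Lemma block_sequence_tail (x : nat -> E) n : block_sequence e x -> tailv n (x n).
Proof.
move=> bx; elim: n => [i|n IH]; first by rewrite ltn0.
have [xn /block_ltP[_ _ [N [Hx Tx]]]] := bx n.
exact: tailS (tail_head_lt xn IH Hx) _ Tx.
Qed.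

Lemma block_subspace_unbounded V : block_subspace e V -> ~ bounded V.
Proof.
move=> [x bx ->]; apply: tail_unbounded => N; exists (x N).
have [xN _] := bx N; split=> //; last exact: block_sequence_tail.
by apply: sub_lspan; exists N.
Qed.

Lemma block_sequenceP (x : nat -> E) : (forall n, x n != 0) ->
  (forall n, precedes (x n) (x n.+1)) -> block_sequence e x.
Proof. by move=> x0 lt n; split=> //; apply/block_ltP. Qed.

End Coordinates.

(** * Block subspaces evading a countable family *)

Lemma infinite_nat_ge (I : set nat) m : infinite_set I -> exists2 n, I n & (m <= n)%N.
Proof.
move=> infI; apply: contrapT => H; apply: infI.
apply: (@sub_finite_set _ _ `I_m); last exact: finite_II.
by move=> n In; rewrite /= ltnNge; apply/negP => mn; apply: H; exists n.
Qed.

Lemma infinite_nat_enum (I : set nat) : infinite_set I ->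
  exists phi : nat -> nat, (forall k, (phi k < phi k.+1)%N) /\ range phi = I.
Proof.
move=> infI.
have next m : {n | [/\ I n, (m <= n)%N & forall k, I k -> (m <= k)%N -> (n <= k)%N]}.
  apply: cid.
  have : exists n, `[<I n>] && (m <= n)%N.
    by have [n In mn] := infinite_nat_ge m infI; exists n; rewrite mn andbT; exact/asboolP.
  case/ex_minnP => n /andP[/asboolP In mn] nmin; exists n; split=> // k Ik mk.
  by apply: nmin; rewrite mk andbT; exact/asboolP.
pose phi := fix phi k := if k is k'.+1 then sval (next (phi k').+1) else sval (next 0%N).
have phiI k : I (phi k).
  by case: k => [|k]; [have [] := svalP (next 0%N)|have [] := svalP (next (phi k).+1)].
have phiS k : (phi k < phi k.+1)%N by have [] := svalP (next (phi k).+1).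
exists phi; split=> //; apply/seteqP; split=> [_ [k _ <-]//|n In].
have phi_ge k : (k <= phi k)%N by elim: k => // k IH; exact: leq_ltn_trans IH (phiS k).
(* For the first k with [n <= phi k], n itself competes in the minimal choice that defines [phi k],
   so [phi k <= n]. *)
have : exists k, (n <= phi k)%N by exists n.
case/ex_minnP => k nk kmin; exists k => //.
apply/eqP; rewrite eqn_leq nk andbT; case: k nk kmin => [|k] nk kmin.
  by have [_ _] := svalP (next 0%N); apply.
have kn : (phi k < n)%N by rewrite ltnNge; apply/negP => /kmin; rewrite ltnn.
by have [_ _] := svalP (next (phi k).+1); apply.
Qed.

Section Evasion.
Local Open Scope ring_scope.
Variables (F : fieldType) (E : lmodType F) (e : nat -> E).
Hypothesis he : is_basis e.
Implicit Types (U V X : set E) (A : nat -> set E) (u v : E) (p : E * E).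

Definition avoids p V := forall u, precedes he u p.1 -> ~ V (p.2 - u).

Definition follows p p' :=
  [/\ p'.1 != 0, p'.2 != 0, precedes he p.2 p'.1 & precedes he p'.1 p'.2].

(** Take [e M] with M past [p.2] as first coordinate. Vectors preceding it lie in one fixed head,
    and by [bounded_translates] U meets the translates of each [A i] by this head in a bounded set.
    A nonzero vector of U that starts far enough out is the second coordinate. *)
Lemma exists_avoiding U A n p : lsubspace U -> ~ bounded he U ->
  (forall i, lsubspace (A i)) ->
  (forall i, (i <= n)%N -> bounded he (U `&` A i)) ->
  exists p', [/\ follows p p', U p'.2 & forall i, (i <= n)%N -> avoids p' (A i)].
Proof.
move=> sU nbU sA bUA; have [M HM] := exists_head he p.2.
have [K HK] : exists K, forall i, (i <= n)%N ->
    U `&` translates (A i) (headv he M.+1) `<=` headv he K.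
  have /choice[k Hk] : forall i, exists k, (i <= n)%N ->
      U `&` translates (A i) (headv he M.+1) `<=` headv he k.
    move=> i; have [le_in|] := boolP (i <= n)%N; last by exists 0%N.
    by have [k] := bounded_translates M.+1 sU (sA i) (bUA i le_in); exists k.
  exists (\max_(i < n.+1) k i)%N => i le_in; apply: subset_trans (Hk i le_in) _.
  by apply: headS; rewrite -ltnS in le_in; exact: (leq_bigmax (Ordinal le_in)).
(* Starting at [M.+1] puts x after [e M]; starting at K keeps it out of the translates. *)
have [x [Ux Tx x0]] := unbounded_tail (maxn K M.+1) sU nbU.
exists (e M, x); split=> //=.
- split=> //=; first exact: basis_neq0.
    by exists M; split=> //; exact: tail_basis.
  by exists M.+1; split; [exact: head_basis|exact: tailS (leq_maxr _ _) _ Tx].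
- move=> i le_in u [N [Hu TeM]] Axu.
  have NM : (N < M.+1)%N.
    exact: tail_head_lt (basis_neq0 he M) TeM (head_basis _ _).
  move/eqP: x0; apply; apply: (@head_tail0 _ _ _ he K).
    apply: (HK i) => //; split=> //; exists u => //.
    exact: headS (ltnW NM) _ Hu.
  exact: tailS (leq_maxl _ _) _ Tx.
Qed.

(** If a combination in V had its last nonzero coefficient at an index k >= i, dividing by that
    coefficient would put [x k] minus a combination of earlier terms into V. So every vector of the
    intersection is a combination of the first i terms. *)
Lemma block_sequence_bounded (x : nat -> E) V i : lsubspace V ->
  (forall k (c : nat -> F), (i <= k)%N -> ~ V (x k - \sum_(j < k) c j *: x j)) ->
  bounded he (lspan (range x) `&` V).
Proof.
move=> sV nV; have [K HK] := choice (exists_head he).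
exists (\max_(j < i) K (x j))%N => v [/lspan_range[N [c [_ vE]]]].
elim: N v vE => [|N IH] v ->.
  by move=> _; rewrite big_ord0; exact: lsubspace0 (head_subspace _ _).
have [Ni _|iN] := ltnP N i.
  apply: lsubspace_sum (head_subspace _ _) _ => j.
  apply: lsubspaceZ (head_subspace _ _) _; apply: headS (HK _).
  exact: (leq_bigmax (Ordinal (leq_trans (ltn_ord j) Ni))).
have [cN0|cN0] := eqVneq (c N) 0.
  by rewrite big_ord_recr /= cN0 scale0r addr0; exact: IH.
move=> /(@lsubspaceZ _ _ _ (c N)^-1 _ sV); rewrite big_ord_recr /= scalerDr scalerA.
rewrite mulVf// scale1r addrC scaler_sumr => Vx; exfalso.
apply: (nV N (fun j => - ((c N)^-1 * c j)) iN).
suff -> : - \sum_(j < N) - ((c N)^-1 * c j) *: x j = \sum_(j < N) (c N)^-1 *: (c j *: x j).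
  by rewrite [X in V X]addrC.
by rewrite -sumrN; apply: eq_bigr => j _; rewrite scaleNr opprK scalerA.
Qed.

Lemma block_pairs_lt (g : nat -> E * E) m n : block_pairs e g -> (m < n)%N ->
  precedes he (g m).2 (g n).1.
Proof.
move=> bg; have lt k : precedes he (g k).2 (g k.+1).1.
  by have [_ _ _ /(block_ltP he)[]] := bg k.
elim: n => // n IH; rewrite ltnS leq_eqVlt => /orP[/eqP ->//|/IH H].
have [n1 n2 /(block_ltP he)[_ _ H'] _] := bg n.
exact: precedes_trans n2 (precedes_trans n1 H H') (lt n).
Qed.

Lemma evading_subspace A (g : nat -> E * E) : (forall i, lsubspace (A i)) ->
  block_pairs e g ->
  let I := [set n | forall i, (i <= n)%N -> avoids (g n) (A i)] in
  infinite_set I ->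
  exists V, [/\ block_subspace e V, forall i, bounded he (V `&` A i)
    & forall X, infinite_set (I `&` [set n | X (g n).2]) -> ~ bounded he (X `&` V)].
Proof.
move=> sA bg I /infinite_nat_enum[phi [phiS phiI]].
have phi_lt m n : (m < n)%N -> (phi m < phi n)%N.
  elim: n => // n IH; rewrite ltnS leq_eqVlt => /orP[/eqP -> //|/IH H].
  exact: ltn_trans H (phiS n).
have phi_ge k : (k <= phi k)%N by elim: k => // k IH; exact: leq_ltn_trans IH (phiS k).
pose x k := (g (phi k)).2.
have g1 n : (g n).1 != 0 by case: (bg n).
have g2 n : (g n).2 != 0 by case: (bg n).
have g12 n : precedes he (g n).1 (g n).2 by have [_ _ /(block_ltP he)[]] := bg n.
have bx : block_sequence e x.
  apply: (@block_sequenceP _ _ _ he) => n; first exact: g2.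
  exact: precedes_trans (g1 _) (block_pairs_lt bg (phiS n)) (g12 _).
exists (lspan (range x)); split; first by exists x.
  move=> i; apply: (block_sequence_bounded (i := i)) => // k c ik.
  have : I (phi k) by rewrite -phiI; exists k.
  (* Since [k <= phi k], the avoidance condition for [A i] holds at every term of x from index i
     on. *)
  move=> /(_ i (leq_trans ik (phi_ge k))); apply.
  apply: precedes_sum => // j; exact: block_pairs_lt bg (phi_lt _ _ _).
move=> X infX; apply: (@tail_unbounded _ _ _ he) => N.
have [n [In Xn] Nn] := infinite_nat_ge N infX.
exists (g n).2; split=> //.
  split=> //; apply: sub_lspan.
  by move: In; rewrite -phiI => -[k _ <-]; exists k.
(* All second coordinates of g, selected or not, form a block sequence; hence [(g n).2] has no
   coordinate below n. *)
have bg2 : block_sequence e (fun n => (g n).2).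
  apply: (@block_sequenceP _ _ _ he) => // m.
  exact: precedes_trans (g1 _) (block_pairs_lt bg (ltnSn m)) (g12 _).
exact: tailS Nn _ (block_sequence_tail he (n := n) bg2).
Qed.

(** The start [(0, 0)] is not part of the resulting sequence, which begins at index 1. It is a
    legitimate start because [follows] does not ask its first argument to be nonzero. *)
Definition run (next : nat -> E * E -> E * E) :=
  fix run n := if n is m.+1 then next m (run m) else (0, 0).

Lemma run_block_pairs (next : nat -> E * E -> E * E) :
  (forall n p, follows p (next n p)) -> block_pairs e (fun n => run next n.+1).
Proof.
move=> fn n; have [n1 n2 _ n12] := fn n (run next n).
have [m1 _ m21 _] := fn n.+1 (run next n.+1).
by split=> //; apply/(block_ltP he).
Qed.

Lemma exists_follows p : exists p', follows p p'.
Proof.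
have [] := @exists_avoiding setT (fun=> [set 0]) 0%N p.
- by apply/lsubspaceP.
- apply: (@tail_unbounded _ _ _ he) => N; exists (e N); split=> //.
    exact: tail_basis.
  exact: basis_neq0.
- by move=> _; exact: lsubspace_set0.
- move=> _ _; exists 0%N => v [_ ->]; exact: lsubspace0 (head_subspace _ _).
- by move=> p' []; exists p'.
Qed.

Lemma exists_evading_subspace A : (forall i, lsubspace (A i)) ->
  (forall n, exists U, [/\ lsubspace U, ~ bounded he U
    & forall i, (i <= n)%N -> bounded he (U `&` A i)]) ->
  exists V, block_subspace e V /\ forall i, bounded he (V `&` A i).
Proof.
move=> sA Uex.
have /choice[next0 H] (np : nat * (E * E)) : exists p',
    follows np.2 p' /\ forall i, (i <= np.1)%N -> avoids p' (A i).
  case: np => n p /=; have [U [sU nbU bUA]] := Uex n.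
  by have [p' [? ? ?]] := exists_avoiding p sU nbU sA bUA; exists p'.
pose next n p := next0 (n, p).
have bg : block_pairs e (fun n => run next n.+1).
  by apply: run_block_pairs => n p; case: (H (n, p)).
have [|V [bV bVA _]] := evading_subspace sA bg; last by exists V.
(* Each pair of the run was chosen to avoid the first members of A, so every index is selected. *)
rewrite (_ : mkset _ = setT); first exact: infinite_nat.
by apply/seteqP; split=> // n _; case: (H (n, run next n)).
Qed.

End Evasion.

(** * Borel choices *)

Section BorelSets.
Variable T : topologicalType.
Implicit Types (P Q : T -> Prop).

Lemma borel_open (A : set T) : open A -> borel A.
Proof. exact: sub_sigma_algebra. Qed.

Lemma borel_set0 : borel (@set0 T).
Proof. exact: sigma_algebra0. Qed.

Lemma borel_setC (A : set T) : borel A -> borel (~` A).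
Proof. by move=> bA; rewrite -setTD; exact: sigma_algebraCD. Qed.

Lemma borel_exists I (P : I -> T -> Prop) : countable [set: I] ->
  (forall i, borel [set t | P i t]) -> borel [set t | exists i, P i t].
Proof.
move=> /countable_injP[h hinj] bP.
rewrite (_ : mkset _ = \bigcup_n [set t | exists2 i, h i = n & P i t]); last first.
  apply/seteqP; split=> [t [i Pit]|t [_ _ [i _ Pit]]]; last by exists i.
  by exists (h i) => //; exists i.
apply: sigma_algebra_bigcup => n.
have [[i hi]|no] := EM (exists i, h i = n).
  rewrite (_ : mkset _ = [set t | P i t]); first exact: bP.
  apply/seteqP; split=> [t [j hj]|t Pit]; last by exists i.
  by rewrite (_ : j = i)//; apply: hinj; rewrite ?inE// hj.
rewrite (_ : mkset _ = set0); first exact: borel_set0.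
by apply/seteqP; split=> // t [i hi _]; apply: no; exists i.
Qed.

Lemma borel_not P : borel [set t | P t] -> borel [set t | ~ P t].
Proof. exact: borel_setC. Qed.

Lemma borel_forall I (P : I -> T -> Prop) : countable [set: I] ->
  (forall i, borel [set t | P i t]) -> borel [set t | forall i, P i t].
Proof.
move=> cI bP; rewrite (_ : mkset _ = [set t | ~ exists i, ~ P i t]).
  apply: borel_not; apply: borel_exists => // i; apply: borel_not; exact: bP.
apply/seteqP; split=> [t Pt [i]|t nP i]; first exact.
by apply: contrapT => nPi; apply: nP; exists i.
Qed.

Lemma borel_const (Q : Prop) : borel [set _ : T | Q].
Proof.
have [q|nq] := EM Q; last first.
  by rewrite (_ : mkset _ = set0); [exact: borel_set0|apply/seteqP; split].
rewrite (_ : mkset _ = setT); first exact: borel_open openT.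
by apply/seteqP; split.
Qed.

Lemma borel_and P Q : borel [set t | P t] -> borel [set t | Q t] ->
  borel [set t | P t /\ Q t].
Proof.
move=> bP bQ.
rewrite (_ : mkset _ = [set t | forall b : bool, if b then P t else Q t]).
  by apply: borel_forall; [exact: countableP|case].
by apply/seteqP; split=> [t [Pt Qt] []//|t H]; split; [exact: (H true)|exact: (H false)].
Qed.

Lemma borel_or P Q : borel [set t | P t] -> borel [set t | Q t] ->
  borel [set t | P t \/ Q t].
Proof.
move=> bP bQ; rewrite (_ : mkset _ = [set t | ~ (~ P t /\ ~ Q t)]).
  by apply: borel_not; apply: borel_and; apply: borel_not.
by apply/seteqP; split=> t /=; have := EM (P t); have := EM (Q t); tauto.
Qed.

Lemma borel_imply P Q : borel [set t | P t] -> borel [set t | Q t] ->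
  borel [set t | P t -> Q t].
Proof.
move=> bP bQ; rewrite (_ : mkset _ = [set t | ~ P t \/ Q t]).
  by apply: borel_or => //; apply: borel_not.
by apply/seteqP; split=> t /=; have := EM (P t); tauto.
Qed.

End BorelSets.

Lemma borel_fun_open (T U : topologicalType) (f : T -> U) :
  (forall A, open A -> borel (f @^-1` A)) -> borel_fun f.
Proof.
move=> fo B; apply: (@smallest_sub _ (sigma_algebra setT) _
  [set C | borel (f @^-1` C)]).
  split; first exact: borel_set0.
    by move=> A bA; rewrite /= setTD preimage_setC; exact: borel_setC.
  by move=> A bA; rewrite /= preimage_bigcup; exact: sigma_algebra_bigcup.
exact: fo.
Qed.

(** The sets containing a cylinder around X form a filter. Fixing one more coordinate shows that it
    converges to X in each discrete factor, hence pointwise, so it contains every neighbourhood of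
    X. *)
Lemma nbhs_cylinder (T : choiceType) (X : {ptws nat -> discrete_topology T})
    (A : set {ptws nat -> discrete_topology T}) : nbhs X A ->
  exists n, forall Y : nat -> T, (forall i, (i < n)%N -> Y i = X i) -> A Y.
Proof.
pose G := [set B : set {ptws nat -> discrete_topology T} |
  exists n, forall Y : nat -> T, (forall i, (i < n)%N -> Y i = X i) -> B Y].
have FG : Filter G.
  split; first by exists 0%N.
    move=> B C [m HB] [n HC]; exists (maxn m n) => Y YX; split.
      by apply: HB => i im; apply: YX; rewrite leq_max im.
    by apply: HC => i im; apply: YX; rewrite leq_max im orbT.
  by move=> B C BC [n HB]; exists n => Y /HB/BC.
suff GX : {ptws, G --> X} by exact: GX.
apply/pointwise_cvgP => n; apply/discrete_cvg.
by exists n.+1 => Y; apply.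
Qed.

Section Selection.
Local Open Scope ring_scope.
Variables (F : fieldType) (E : lmodType F) (e : nat -> E).
Hypotheses (he : is_basis e) (hE : countable [set: E]).

Lemma countable_pairs : countable [set: E * E].
Proof. by rewrite -setXTT; exact: countableX. Qed.

(** An open set is the union of the cylinders inside it. There are only countably many cylinders,
    since finite sequences over a countable set are countable. *)
Lemma borel_fun_bb (T : topologicalType) (f : T -> bb_infty e) :
  (forall n p, borel [set t | val (f t) n = p]) -> borel_fun f.
Proof.
move=> bf; apply: borel_fun_open => _ [B oB <-].
pose cyl (s : seq (E * E)) (Y : nat -> E * E) :=
  forall i, (i < size s)%N -> Y i = nth 0 s i.
rewrite (_ : _ @^-1` _ = [set t | exists s : seq (E * E),
    (forall Y, cyl s Y -> B Y) /\ cyl s (val (f t))]); last first.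
  apply/seteqP; split=> [t Bt|t [s [sB]]]; last exact: sB.
  have /nbhs_cylinder[n Hn] : nbhs (val (f t)) B by apply: open_nbhs_nbhs.
  exists (mkseq (val (f t)) n); split=> [Y|i]; rewrite /cyl size_mkseq.
    by move=> H; apply: Hn => i lt_in; rewrite H// nth_mkseq.
  by move=> lt_in; rewrite nth_mkseq.
apply: borel_exists.
  have /countable_injP[h hinj] := countable_pairs.
  apply/countable_injP; exists (fun s => pickle (map h s)) => s s' _ _.
  move/(pcan_inj pickleK); apply: inj_map => x y; apply: hinj; exact: in_setT.
move=> s; apply: borel_and; first exact: borel_const.
apply: borel_forall => [|i]; first exact: countableP.
by apply: borel_imply; [exact: borel_const|exact: bf].
Qed.

(* The least solution in a fixed enumeration is a Borel choice. *)
Lemma borel_choice (T : topologicalType) (P : E * E -> T -> Prop) :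
  (forall p, borel [set t | P p t]) -> forall d : E * E,
  exists c : T -> E * E, [/\ forall p, borel [set t | c t = p],
    forall t, (exists p, P p t) -> P (c t) t
    & forall t, ~ (exists p, P p t) -> c t = d].
Proof.
move=> bP d; have /countable_injP[h hinj] := countable_pairs.
have h_inj p q : h p = h q -> p = q by apply: hinj; exact: in_setT.
pose least p t := P p t /\ forall q, P q t -> (h p <= h q)%N.
have leastE t : (exists p, P p t) -> exists p, least p t.
  move=> [p0 Pp0].
  have : exists n, `[<exists2 p, P p t & h p = n>].
    by exists (h p0); apply/asboolP; exists p0.
  case/ex_minnP => n /asboolP[p Pp <-] min; exists p; split=> // q Pq.
  by apply: min; apply/asboolP; exists q.
have least_uniq t p q : least p t -> least q t -> p = q.
  move=> [Pp pm] [Pq qm]; apply: h_inj; apply/eqP.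
  by rewrite eqn_leq pm// qm.
pose c t := xget d [set p | least p t].
have cP t p : least p t -> c t = p.
  rewrite /c => lp; case: xgetP => [q _ lq|/(_ p)//].
  exact: least_uniq lq lp.
have cd t : ~ (exists p, P p t) -> c t = d.
  by move=> no; rewrite /c; case: xgetP => // p _ [Pp _]; case: no; exists p.
exists c; split=> //; last by move=> t /leastE[p lp]; rewrite (cP t p lp); case: lp.
move=> p; rewrite (_ : mkset _ =
  [set t | least p t \/ (d = p /\ ~ exists q, P q t)]).
  apply: borel_or.
    apply: borel_and; first exact: bP.
    apply: borel_forall => [|q]; first exact: countable_pairs.
    by apply: borel_imply; [exact: bP|exact: borel_const].
  apply: borel_and; first exact: borel_const.
  apply: borel_not; apply: borel_exists => [|q]; first exact: countable_pairs.
  exact: bP.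
apply/seteqP; split=> [t <-|t [/cP//|[<- /cd//]]].
have [/leastE[q lq]|no] := EM (exists q, P q t); last by right; rewrite cd.
by left; rewrite (cP t q lq).
Qed.

(** The pairs of [exists_avoiding] are picked by [borel_choice], with an arbitrary continuation as
    default: [Psi t] must be a block sequence of pairs even at those t where the hypotheses on X and
    A fail. *)
Lemma borel_evading_pairs (T : topologicalType) (X : T -> set E)
    (A : T -> nat -> set E) :
  (forall v, open [set t | X t v]) -> (forall i v, open [set t | A t i v]) ->
  exists Psi : T -> bb_infty e, borel_fun Psi /\
    forall t, lsubspace (X t) -> ~ bounded he (X t) ->
      (forall i, lsubspace (A t i)) -> (forall i, bounded he (X t `&` A t i)) ->
      forall n, X t (val (Psi t) n).2 /\
        forall i, (i <= n)%N -> avoids he (val (Psi t) n) (A t i).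
Proof.
move=> oX oA.
pose good n p p' t := [/\ follows he p p', X t p'.2 &
  forall i, (i <= n)%N -> avoids he p' (A t i)].
have bgood n p p' : borel [set t | good n p p' t].
  rewrite (_ : mkset _ = [set t | follows he p p' /\ (X t p'.2 /\
    forall i, (i <= n)%N -> forall u, precedes he u p'.1 -> ~ A t i (p'.2 - u))]).
    apply: borel_and; first exact: borel_const.
    apply: borel_and; first exact: borel_open.
    apply: borel_forall => [|i]; first exact: countableP.
    apply: borel_imply; first exact: borel_const.
    apply: borel_forall => // u; apply: borel_imply; first exact: borel_const.
    by apply: borel_not; apply: borel_open.
  by apply/seteqP; split=> [t []//|t [? []]].
have /choice[d dP] : forall p, exists p', follows he p p' by exact: exists_follows.
have /choice[c cP] (np : nat * (E * E)) :=
  borel_choice (bgood np.1 np.2) (d np.2).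
pose next t n p := c (n, p) t.
have next_good t n p : (exists p', good n p p' t) -> good n p (next t n p) t.
  by have [_ H _] := cP (n, p); exact: H.
have next_follows t n p : follows he p (next t n p).
  have [/next_good[]//|no] := EM (exists p', good n p p' t).
  by have [_ _ H] := cP (n, p); rewrite /next (H t no).
pose Psi t : bb_infty e :=
  SigSub (mem_set (run_block_pairs (next_follows t))).
exists Psi; split.
  apply: borel_fun_bb => n.
  change (forall p, borel [set t | run (next t) n.+1 = p]).
  elim: n.+1 => {n} [|n IH] p; first exact: (@borel_const T ((0, 0) = p)).
  (* The next pair depends on t also through the preceding one, so the set is split along the
     countably many possible values q of the latter. *)
  rewrite (_ : mkset _ = [set t | exists q, run (next t) n = q /\ next t n q = p]).
    apply: borel_exists => [|q]; first exact: countable_pairs.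
    apply: borel_and; first exact: IH.
    case: (cP (n, q)) => H _ _; exact: H.
  by apply/seteqP; split=> [t H|t [q [<-]]//]; exists (run (next t) n).
move=> t sX nbX sA bXA n.
have [|_ Xn avn] := next_good t n (run (next t) n).
  exact: exists_avoiding.
by [].
Qed.

End Selection.

(** * The first uncountable ordinal *)

Lemma infinite_set_seq T (A : set T) : infinite_set A ->
  exists2 u : nat -> T, injective u & forall n, A (u n).
Proof.
move=> /infiniteP/card_leP[f].
exists (fun n => val (f (SigSub (mem_set I : n \in [set: nat])))).
  move=> m n /val_inj/(inj (f := f)) H.
  by have := congr1 val (H (in_setT _) (in_setT _)).
by move=> n; exact: set_mem (valP (f _)).
Qed.

Lemma injective_card_le T U (f : T -> U) (B : set U) :
  injective f -> (forall x, B (f x)) -> [set: T] #<= B.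
Proof.
move=> finj fB; apply: (@card_le_trans _ _ _ (range f)).
  have := inj_card_eq (in2W finj : {in [set: T] &, injective f}).
  by rewrite card_eq_le => /andP[].
by apply: subset_card_le => _ [x _ <-].
Qed.

Lemma countable_setU T (A B : set T) : countable A -> countable B ->
  countable (A `|` B).
Proof. by move=> cA cB; rewrite -bigcup2E; apply: bigcup_countable => // -[|[|i]]. Qed.

Section Omega1.
Variables (d : Order.disp_t) (W : orderType d).
Hypothesis hW : is_omega1 W.
Implicit Types (x y z : W).
Local Open Scope order_scope.

Lemma omega1_min (P : W -> Prop) : (exists x, P x) ->
  exists m, P m /\ forall x, P x -> m <= x.
Proof.
move=> [x Px]; have [wo _ _] := hW.
have [|m [[mP mmin] _]] := wo [pred x | `[<P x>]].
  by exists x; apply/asboolP.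
exists m; split; first exact/asboolP.
by move=> y Py; apply: mmin; apply/asboolP.
Qed.

Lemma omega1_wf : well_founded (fun x y : W => x < y).
Proof.
move=> x; apply: contrapT => nAx.
have [|m [nAm mmin]] := @omega1_min (fun x => ~ Acc (fun x y : W => x < y) x).
  by exists x.
apply: nAm; constructor => y ym; apply: contrapT => /mmin.
by rewrite leNgt ym.
Qed.

(** Transfinite recursion with a choice at each stage: [R x h t] means that t is an admissible value
    at x after the values of h below x. The first hypothesis says that only those values matter, the
    second that admissible choices never get stuck. *)
Lemma omega1_recursion T (R : W -> (W -> T) -> T -> Prop) : T ->
  (forall x h h' t, (forall y, y < x -> h y = h' y) -> R x h t -> R x h' t) ->
  (forall x h, (forall y, y < x -> R y h (h y)) -> exists t, R x h t) ->
  exists h, forall x, R x h (h x).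
Proof.
move=> t0 Rloc Rex.
(* [sel] is total, so it may return a junk value when nothing is admissible; the final induction
   shows that this never happens along h. *)
have /choice[sel selP] (xh : W * (W -> T)) : exists t,
    (exists t, R xh.1 xh.2 t) -> R xh.1 xh.2 t.
  have [[t Rt]|no] := EM (exists t, R xh.1 xh.2 t); first by exists t.
  by exists t0 => /no.
pose trunc x (rec : forall y, y < x -> T) y : T :=
  if pselect (y < x) is left yx then rec y yx else t0.
pose h := Fix omega1_wf (fun=> T) (fun x rec => sel (x, trunc x rec)).
have hE x : h x = sel (x, fun y => if pselect (y < x) then h y else t0).
  rewrite /h Fix_eq//.
    by congr (sel (_, _)); apply/funext => y; rewrite /trunc; case: pselect.
  move=> {}x f f' ff'; congr (sel (_, _)); apply/funext => y.
  by rewrite /trunc; case: pselect.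
have trE x y : y < x -> (if pselect (y < x) then h y else t0) = h y.
  by move=> yx; case: pselect.
exists h; apply: (well_founded_ind omega1_wf) => x IH.
apply: (Rloc x (fun y => if pselect (y < x) then h y else t0)) => [y /trE//|].
rewrite [h x]hE; apply: (selP (x, _)) => /=.
have [t Rt] := Rex x h IH; exists t.
by apply: Rloc Rt => y /trE.
Qed.

Lemma omega1_nonempty : [set: W] !=set0.
Proof.
have [_ ncW _] := hW.
by apply/set0P/eqP => W0; apply: ncW; rewrite W0; exact: countable0.
Qed.

Lemma countable_below x : countable [set y | y < x].
Proof. by case: hW. Qed.

(** By recursion, each x receives an element of S different from those used before; these are
    countably many and cannot exhaust S. *)
Lemma omega1_le_uncountable U (S : set U) : ~ countable S -> [set: W] #<= S.
Proof.
move=> ncS.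
have [t0 St0] : S !=set0.
  by apply/set0P/eqP => S0; apply: ncS; rewrite S0; exact: countable0.
have [h hP] : exists h : W -> U, forall x, S (h x) /\ forall y, y < x -> h y <> h x.
  apply: (@omega1_recursion U (fun x h t => S t /\ forall y, y < x -> h y <> t)) => //.
    by move=> x h h' t hh' [St ht]; split=> // y yx; rewrite -hh'//; exact: ht.
  move=> x h _; apply: contrapT => no; apply: ncS.
  apply: (@sub_countable _ _ _ (h @` [set y | y < x])); last first.
    exact: sub_countable (card_image_le _ _) (countable_below x).
  apply: subset_card_le => t St; apply: contrapT => nt; apply: no.
  by exists t; split=> // y yx hy; apply: nt; exists y.
have hinj : injective h.
  move=> x y hxy; apply/eqP; case: (ltgtP x y) => // xy; exfalso.
    by have [_ /(_ x xy)] := hP y.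
  by have [_ /(_ y xy)] := hP x; apply.
by apply: (injective_card_le hinj) => x; case: (hP x).
Qed.

(** This lets one function [W -> bool] store a subset of I for every element of W. At stage x the
    codes used so far form a countable set [C], and an infinite sequence outside [C] provides the
    new ones. *)
Lemma omega1_coding I : countable [set: I] ->
  exists h : W -> I -> W, forall x y a b, h x a = h y b -> x = y /\ a = b.
Proof.
move=> /countable_injP[c cinj]; have [_ ncW _] := hW.
have [x0 _] := omega1_nonempty.
have [h hP] : exists h : W -> I -> W, forall x, injective (h x) /\
    forall y, y < x -> forall a b, h y a <> h x b.
  apply: (@omega1_recursion _ (fun x h t => injective t /\
    forall y, y < x -> forall a b, h y a <> t b)) => [//| |].
    by move=> x h h' t hh' [ti ht]; split=> // y yx a b; rewrite -hh'//; exact: ht.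
  move=> x h _; pose C := \bigcup_(y in [set y | y < x]) range (h y).
  have cC : countable C.
    apply: bigcup_countable; first exact: countable_below.
    move=> y _; apply: sub_countable (card_image_le _ _) _.
    by apply/countable_injP; exists c.
  have [|u uinj uC] := @infinite_set_seq _ (~` C).
    move=> finC; apply: ncW; rewrite -(setUv C); apply: countable_setU => //.
    exact: finite_set_countable.
  exists (u \o c); split.
    by move=> a b /uinj; apply: cinj; exact: in_setT.
  move=> y yx a b hy; apply: (uC (c b)); exists y => //; exists a => //.
exists h => x y a b hxy; have [xi hx] := hP x; have [yi hy] := hP y.
case: (ltgtP x y) => xy.
- by case: (hy x xy a b).
- by case: (hx y xy b a).
- by split=> //; apply: yi; rewrite -hxy xy.
Qed.

Lemma countable_bounded (C : set W) : countable C -> exists b, forall y, C y -> y < b.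
Proof.
move=> cC; apply: contrapT => no; have [_ ncW _] := hW; apply: ncW.
rewrite (_ : setT = \bigcup_(c in C) ([set y | y < c] `|` [set c])).
  apply: bigcup_countable => // c _; apply: countable_setU; first exact: countable_below.
  exact: countable1.
apply/seteqP; split=> // b _; apply: contrapT => nb; apply: no; exists b => y Cy.
rewrite ltNge le_eqVlt; apply/negP => /orP[/eqP by_|by_]; apply: nb; exists y => //.
  by right.
by left.
Qed.

(** To get a closure point above x, iterate countably often a bound on the values of h and take the
    least strict upper bound of the iterates. The minimum of W is excluded so that a closure point
    always has an index below it. *)
Lemma club_closure_points I (h : W -> I -> W) : countable [set: I] ->
  club [set x | (exists y, y < x) /\ forall y a, y < x -> h y a < x].
Proof.
move=> cI; split; last first.
  move=> x xmin xlim; split=> // y a /xlim[z [_ zh] /andP[yz zx]].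
  exact: lt_trans (zh y a yz) zx.
move=> x.
have /choice[next nextP] z : exists b, z < b /\ forall y a, y <= z -> h y a < b.
  pose C := [set z] `|` \bigcup_(y in [set y | y < z] `|` [set z]) range (h y).
  have [|b bC] := @countable_bounded C.
    apply: countable_setU; first exact: countable1.
    apply: bigcup_countable.
      by apply: countable_setU; [exact: countable_below|exact: countable1].
    by move=> y _; exact: sub_countable (card_image_le _ _) cI.
  exists b; split; first by apply: bC; left.
  move=> y a; rewrite le_eqVlt => yz; apply: bC; right; exists y; last by exists a.
  by case/orP: yz => [/eqP ->|]; [right|left].
pose u n := iter n next x.
have [|m [um mmin]] := @omega1_min (fun b => forall n, u n < b).
  have [|b bu] := @countable_bounded (range u).
    by apply: sub_countable (card_image_le _ _) (countableP _).
  by exists b => n; apply: bu; exists n.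
exists m; last exact: (um 0%N).
split; first by exists x; exact: (um 0%N).
(* Otherwise y would itself be a strict upper bound of the iterates, below the least one. *)
move=> y a ym; have [n yn] : exists n, y <= u n.
  apply: contrapT => no; move: ym; rewrite ltNge mmin// => n.
  by rewrite ltNge; apply/negP => yn; apply: no; exists n.
by apply: lt_trans (um n.+1); have [_] := nextP (u n); apply.
Qed.

End Omega1.

(** * Almost disjoint families *)

Section Families.
Local Open Scope ring_scope.
Variables (F : fieldType) (E : lmodType F) (e : nat -> E).
Hypothesis he : is_basis e.
Implicit Types (U V X : set E) (u v : E).

Lemma exists_disjoint_blocks : exists P : nat -> set E,
  (forall n, block_subspace e (P n)) /\
  forall m n, m <> n -> bounded he (P m `&` P n).
Proof.
(* [b n] enumerates increasingly the positive integers of 2-adic valuation n, so distinct n use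
   disjoint sets of basis vectors. *)
pose b n k := (2 ^ n * k.*2.+1)%N.
have b_inj m n i j : b m i = b n j -> m = n.
  move=> bmn; have logb p k : logn 2 (b p k) = p.
    rewrite /b lognM ?expn_gt0// pfactorK// (_ : logn 2 _ = 0)%N ?addn0//.
    by rewrite logn_coprime// coprime2n /= odd_double.
  by rewrite -(logb m i) bmn logb.
have b_lt n k : (b n k < b n k.+1)%N by rewrite /b ltn_pmul2l ?expn_gt0// ltnS doubleS.
exists (fun n => lspan (range (e \o b n))); split=> [n|m n mn].
  exists (e \o b n) => //; apply: (block_sequenceP (he := he)) => k.
    exact: (basis_neq0 he (b n k)).
  exists (b n k).+1; split; first exact: (head_basis he (ltnSn _)).
  exact: (tail_basis he (b_lt n k)).
pose supported n := [set v | forall i, (forall k, b n k <> i) -> bcoef he v i = 0].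
have sub n' : lspan (range (e \o b n')) `<=` supported n'.
  apply: lspan_sub => [|_ [k _ <-] i bi].
    apply/lsubspaceP; split=> [i _|a u v Hu Hv i bi]; first exact: bcoef0.
    by rewrite bcoefZD Hu// Hv// mulr0 addr0.
  rewrite /= bcoef_basis; case: eqP => // ib; by case: (bi k).
exists 0%N => v [/sub Hm /sub Hn] i _.
have [[k bk]|no] := EM (exists k, b m k = i); last first.
  by apply: Hm => k bk; apply: no; exists k.
by apply: Hn => j bj; apply: mn; apply: (b_inj _ _ k j); rewrite bk bj.
Qed.

Lemma almost_disjoint_pair (S : set (set E)) U V : almost_disjoint_family S ->
  S U -> S V -> U <> V -> bounded he (U `&` V).
Proof. by move=> [_ ad] SU SV UV; apply: finite_dim_bounded; exact: ad. Qed.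

Lemma almost_disjointP (S : set (set E)) : almost_disjoint_family S <->
  (forall V, S V -> lsubspace V /\ ~ bounded he V) /\
  (forall U V, S U -> S V -> U <> V -> bounded he (U `&` V)).
Proof.
split=> [adS|[sS ad]]; split.
- move=> V SV; have [/(_ V SV)[sV fdV] _] := adS; split=> //.
  by move=> /(finite_dimP he sV).
- by move=> U V; exact: almost_disjoint_pair.
- move=> V SV; have [sV nbV] := sS V SV; split=> //.
  by move=> /(finite_dimP he sV).
- move=> U V SU SV UV; apply/(finite_dimP he); last exact: ad.
  by apply: lsubspaceI; [case: (sS U SU)|case: (sS V SV)].
Qed.

Lemma mad_uncountable (S : set (set E)) :
  infinite_mad_block_family e S -> ~ countable S.
Proof.
move=> [[/almost_disjointP[sS adS] maxS] infS bS] cS.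
have /pcard_eqP[A] : [set: nat] #= S.
  by rewrite card_eq_le; apply/andP; split; first exact/infiniteP.
have AS i : S (A i) by exact: funS.
have Ainj i j : A i = A j -> i = j by apply: inj; exact: in_setT.
have [i|n|V [bV adV]] := @exists_evading_subspace _ _ _ he A.
- by case: (sS _ (AS i)).
- exists (A n.+1); split; [by case: (sS _ (AS n.+1))|by case: (sS _ (AS n.+1))|].
  move=> i le_in; apply: adS => // /Ainj iE.
  by move: le_in; rewrite -iE ltnn.
have adV' U : S U -> bounded he (V `&` U).
  move=> SU; have [i _ <-] := surj (f := A) SU; exact: adV.
have nbV := block_subspace_unbounded (he := he) bV.
apply: (maxS (S `|` [set V])); last first.
  split=> [U SU|sub]; first by left.
  (* V is not in S, since it is almost disjoint from every member of S but not from itself. *)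
  by apply: nbV; rewrite -[V]setIid; apply: adV'; apply: sub; right.
apply/almost_disjointP; split=> [U [/sS//|->]|].
  by split=> //; exact: block_subspace_subspace bV.
move=> U U' [SU|->] [SU'|->] //.
- exact: adS.
- by move=> _; rewrite setIC; exact: adV'.
- by move=> _; exact: adV'.
Qed.

(** * Enumerating a countable family along an injective code *)

Variables (I : Type) (Z : set I) (code : I -> nat) (V : I -> set E).

(** An index that codes nothing lists the zero subspace, so that every index gives a subspace. The
    existential form makes membership of v an open condition whenever the sets [V z] depend on a
    parameter through open conditions. *)
Definition listing i : set E :=
  [set v | v = 0 \/ exists z, [/\ Z z, code z = i & V z v]].

Hypothesis code_inj : forall z z', Z z -> Z z' -> code z = code z' -> z = z'.
Hypothesis subV : forall z, Z z -> lsubspace (V z).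

Lemma listing_code z : Z z -> listing (code z) = V z.
Proof.
move=> Zz; apply/seteqP; split=> [v [->|[z' [Zz' /code_inj <-//]]]|v Vv].
  by apply: lsubspace0; exact: subV.
by right; exists z.
Qed.

Lemma listingP i : listing i = [set 0] \/ exists2 z, Z z & code z = i.
Proof.
have [|no] := EM (exists2 z, Z z & code z = i); first by right.
left; apply/seteqP; split=> [v [->//|[z [Zz zi _]]]|v ->]; last by left.
by exfalso; apply: no; exists z.
Qed.

Lemma listing_subspace i : lsubspace (listing i).
Proof.
have [->|[z Zz <-]] := listingP i; first exact: lsubspace_set0.
by rewrite listing_code//; exact: subV.
Qed.

Lemma listing_bounded X i : (forall z, Z z -> code z = i -> bounded he (X `&` V z)) ->
  bounded he (X `&` listing i).
Proof.
move=> bX; have [->|[z Zz zi]] := listingP i.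
  by exists 0%N => v [_ ->]; exact: lsubspace0 (head_subspace _ _).
by rewrite -zi listing_code//; exact: bX.
Qed.

End Families.

Section OpenSets.
Variable T : topologicalType.

Lemma open_exists J (P : J -> T -> Prop) :
  (forall j, open [set t | P j t]) -> open [set t | exists j, P j t].
Proof.
move=> oP; rewrite (_ : mkset _ = \bigcup_j [set t | P j t]).
  by apply: bigcup_open => j _; exact: oP.
by apply/seteqP; split=> [t [j Pj]|t [j _ Pj]]; exists j.
Qed.

Lemma open_const_and (Q : Prop) (P : T -> Prop) :
  open [set t | P t] -> open [set t | Q /\ P t].
Proof.
move=> oP; have [q|nq] := EM Q.
  by rewrite (_ : mkset _ = [set t | P t])//; apply/seteqP; split=> t //= [].
by rewrite (_ : mkset _ = set0); [exact: open0|apply/seteqP; split=> t //= []].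
Qed.

Lemma open_const (Q : Prop) : open [set _ : T | Q].
Proof.
rewrite (_ : mkset _ = [set t | Q /\ True]); first exact/open_const_and/openT.
by apply/seteqP; split=> t //= [].
Qed.

End OpenSets.

Lemma open_coordinate (I : eqType) (i : I) : open [set t : {ptws I -> bool} | t i].
Proof.
rewrite (_ : mkset _ = (fun t : {ptws I -> bool} => t i) @^-1` [set true]); last first.
  by apply/seteqP; split.
apply: open_comp; last exact: discrete_open.
by move=> t _; exact: (@proj_continuous _ (fun=> bool : topologicalType) i).
Qed.

(** * The construction *)

Section Construction.
Local Open Scope ring_scope.
Variables (d : Order.disp_t) (W : orderType d) (hW : is_omega1 W).
Variables (F : fieldType) (E : lmodType F) (e : nat -> E) (he : is_basis e).
Variable P : nat -> set E.
Hypothesis bP : forall n, block_subspace e (P n).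
Hypothesis adP : forall m n, m <> n -> bounded he (P m `&` P n).
Variable rank : W -> W -> nat.
Hypothesis rank_inj : forall x y y', (y < x)%O -> (y' < x)%O ->
  rank x y = rank x y' -> y = y'.
Implicit Types (V : W -> set E) (X Y : set E).

Definition member V (z : nat + W) : set E :=
  match z with inl n => P n | inr x => V x end.

Definition before x (z : nat + W) : Prop :=
  if z is inr y then (y < x)%O else True.

(** The numbering depends on x because only the members before x are countably many. *)
Definition code x (z : nat + W) : nat :=
  match z with inl n => n.*2 | inr y => (rank x y).*2.+1 end.

Lemma code_inj x z z' : before x z -> before x z' -> code x z = code x z' -> z = z'.
Proof.
case: z z' => [n|y] [n'|y'] /= yx yx' H.
- by rewrite (double_inj H).
- by have := congr1 odd H; rewrite /= !odd_double.
- by have := congr1 odd H; rewrite /= !odd_double.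
- by case: H => /double_inj/(rank_inj yx yx') ->.
Qed.

Definition earlier V x := listing (before x) (code x) (member V).

(** The last clause is vacuous when p avoids the earlier members at only finitely many indices, so
    that a suitable X exists even for a useless guess p. *)
Definition evades (p : nat -> E * E) x V X :=
  [/\ block_subspace e X,
      forall z, before x z -> bounded he (X `&` member V z)
    & forall Y, infinite_set [set n | (forall i, (i <= n)%N ->
          avoids he (p n) (earlier V x i)) /\ Y (p n).2] ->
        ~ bounded he (Y `&` X)].

Lemma member_block V (D : set W) : (forall x, D x -> block_subspace e (V x)) ->
  forall z, (if z is inr x then D x else True) -> block_subspace e (member V z).
Proof. by move=> bV [n|x] /= Dx; [exact: bP|exact: bV]. Qed.

Lemma member_bounded V (g : W -> nat -> E * E) (D : set W) :
  (forall x, D x -> evades (g x) x V (V x)) ->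
  forall z z', (if z is inr x then D x else True) ->
    (if z' is inr x then D x else True) -> z <> z' ->
  bounded he (member V z `&` member V z').
Proof.
move=> gV [n|x] [n'|x'] /= Dz Dz' zz'.
- by apply: adP => nn'; apply: zz'; rewrite nn'.
- by rewrite setIC; have [_ /(_ (inl n) I)] := gV x' Dz'.
- by have [_ /(_ (inl n') I)] := gV x Dz.
- case: (ltgtP x x') => xx'.
  + by rewrite setIC; have [_ /(_ (inr x) xx')] := gV x' Dz'.
  + by have [_ /(_ (inr x') xx')] := gV x Dz.
  + by case: zz'; rewrite xx'.
Qed.

Lemma member_local V V' x z : (forall y, (y < x)%O -> V y = V' y) ->
  before x z -> member V z = member V' z.
Proof. by case: z => //= y VV' /VV'. Qed.

Lemma earlier_local V V' x : (forall y, (y < x)%O -> V y = V' y) ->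
  earlier V x = earlier V' x.
Proof.
move=> VV'; apply/funext => i; apply/seteqP; split=> v.
  move=> [->|[z [zx zi Vz]]]; [by left|right; exists z; split=> //].
  by rewrite -(member_local VV').
move=> [->|[z [zx zi Vz]]]; [by left|right; exists z; split=> //].
by rewrite (member_local VV').
Qed.

Lemma exists_evades (p : nat -> E * E) V x (g : W -> nat -> E * E) :
  block_pairs e p -> (forall y, (y < x)%O -> evades (g y) y V (V y)) ->
  exists X, evades p x V X.
Proof.
move=> pp gV.
have bV z : before x z -> block_subspace e (member V z).
  by apply: (@member_block _ [set y | (y < x)%O]) => y /gV[].
have sV z : before x z -> lsubspace (member V z).
  by move=> /bV; exact: block_subspace_subspace.
have adV : forall z z', before x z -> before x z' -> z <> z' ->
    bounded he (member V z `&` member V z').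
  exact: (@member_bounded V g [set y | (y < x)%O]).
have sA i : lsubspace (earlier V x i).
  by apply: listing_subspace => //; exact: code_inj.
have VA z : before x z -> earlier V x (code x z) = member V z.
  by move=> zx; apply: listing_code => //; exact: code_inj.
pose I := [set n | forall i, (i <= n)%N -> avoids he (p n) (earlier V x i)].
(* If the guess p is useful infinitely often, X is spanned by its selected vectors. Otherwise any
   block subspace almost disjoint from the earlier members will do. *)
have [finI|infI] := EM (finite_set I); last first.
  have [X [bX bXA nbX]] := evading_subspace sA pp infI.
  by exists X; split=> // z zx; rewrite -VA.
have [n|X [bX bXA]] := @exists_evading_subspace _ _ _ he _ sA.
  (* [P n.+1] has code 2n+2 > n, so it differs from every member listed at an index at most n. *)
  exists (P n.+1); split.
  - exact: block_subspace_subspace (bP _).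
  - exact: block_subspace_unbounded (bP _).
  - move=> i le_in; apply: (listing_bounded (@code_inj x) sV) => z zx zi.
    apply: (adV (inl n.+1)) => // zE; move: le_in; rewrite -zi -zE /= -addnn.
    by rewrite addSn ltnNge leq_addr.
exists X; split=> // [z zx|Y infY]; first by rewrite -VA.
by exfalso; apply: infY; apply: sub_finite_set finI => n [].
Qed.

Lemma exists_evading_family (g : W -> nat -> E * E) :
  (forall x, block_pairs e (g x)) -> exists V, forall x, evades (g x) x V (V x).
Proof.
move=> pg; apply: (omega1_recursion hW (R := fun x => evades (g x) x)).
- exact: set0.
- move=> x V V' X VV' [bX bXV nbX]; split=> // [z zx|Y].
    by rewrite -(member_local VV')//; exact: bXV.
  by rewrite -(earlier_local VV'); exact: nbX.
- by move=> x V gV; exact: exists_evades (pg x) gV.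
Qed.

End Construction.

(** * The mad family obtained from the guesses *)

Theorem theorem3p1 (d : Order.disp_t) (W : orderType d) (hW : is_omega1 W)
  (F : fieldType) (hF : countable [set: F])
  (E : lmodType F) (e : nat -> E) (he : is_basis e) :
  diamond W (@eq_infinitely_often F E e) ->
  min_card_eq (@infinite_mad_block_family F E e) [set: W].
Proof.
move=> dia; split; last first.
  by move=> S /(mad_uncountable he); exact: omega1_le_uncountable.
have cE : countable [set: E] := countable_space he hF.
have [P [bP adP]] := exists_disjoint_blocks he.
have [rank rank_inj] : exists rank : W -> W -> nat, forall x y y',
    (y < x)%O -> (y' < x)%O -> rank x y = rank x y' -> y = y'.
  have /choice[rank rankP] x : exists r : W -> nat, forall y y',
      (y < x)%O -> (y' < x)%O -> r y = r y' -> y = y'.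
    have /countable_injP[r rinj] := countable_below hW x.
    by exists r => y y' yx yx'; apply: rinj; exact: mem_set.
  by exists rank.
have [h hinj] : exists h : W -> bool * E -> W, forall x y a b,
    h x a = h y b -> x = y /\ a = b.
  by apply: omega1_coding => //; rewrite -setXTT; apply: countableX.
(* A function t on [below x] is read as a code for subspaces: the bit at [h y (false, v)] tells
   whether v lies in the y-th subspace, the bit at [h y (true, v)] whether v lies in the candidate
   X. *)
pose coded x (t : {ptws below x -> bool}) b y : set E :=
  [set v | exists w : below x, val w = h y (b, v) /\ t w].
(* The candidate will be coded in the same way at every y, so the union over all [y < x] recovers it
   as soon as one such y exists. *)
pose candidate x t : set E := [set v | exists y, (y < x)%O /\ coded x t true y v].
pose family x t := earlier P rank (coded x t false) x.
have Phi_ex x : {Phi : {ptws below x -> bool} -> bb_infty e |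
  borel_fun Phi /\ forall t, lsubspace (candidate x t) -> ~ bounded he (candidate x t) ->
      (forall i, lsubspace (family x t i)) ->
      (forall i, bounded he (candidate x t `&` family x t i)) ->
      forall n, candidate x t (val (Phi t) n).2 /\
        forall i, (i <= n)%N -> avoids he (val (Phi t) n) (family x t i)}.
  apply: cid.
  have o_coded b y v : open [set t | coded x t b y v].
    by apply: open_exists => w; apply: open_const_and; exact: open_coordinate.
  apply: borel_evading_pairs => //.
    by move=> v; apply: open_exists => y; exact: open_const_and.
  move=> i v.
  (* [None] stands for the zero vector, which belongs to every listed subspace; each case is then an
     open condition on t. *)
  rewrite (_ : mkset _ = [set t | exists o : option (nat + W),
      match o with
      | None => v = 0%R
      | Some z => (before x z /\ code rank x z = i) /\ member P (coded x t false) z v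
      end]).
    apply: open_exists => -[[n|y]|]; last exact: open_const.
      by apply: open_const_and; exact: open_const.
    by apply: open_const_and; exact: o_coded.
  apply/seteqP; split=> t.
    by move=> [->|[z [? ? ?]]]; [exists None|exists (Some z)].
  by move=> [[z [[? ?] ?]|->]]; [right; exists z|left].
(* There is no circularity: [Phi] reads the earlier subspaces off the code t, so the guesses g exist
   before V is built from them. *)
have [g gP] := dia (fun x => sval (Phi_ex x)) (fun x => (svalP (Phi_ex x)).1).
have pg x : block_pairs e (val (g x)) by exact: set_mem (valP (g x)).
have [V VP] := exists_evading_family hW bP adP rank_inj pg.
pose S := range (member P V).
have bV z : block_subspace e (member P V z).
  by apply: (member_block bP (D := setT)); [move=> x _; case: (VP x)|case: z].
have sV z : lsubspace (member P V z) := block_subspace_subspace (bV z).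
have adV z z' : z <> z' -> bounded he (member P V z `&` member P V z').
  by apply: (member_bounded adP (D := setT) (fun x _ => VP x)); [case: z|case: z'].
have Vinj z z' : member P V z = member P V z' -> z = z'.
  move=> zz'; apply: contrapT => /adV.
  rewrite -zz' setIid; exact: block_subspace_unbounded (bV z).
have adS : almost_disjoint_family S.
  apply/(almost_disjointP he); split=> [_ [z _ <-]|_ _ [z _ <-] [z' _ <-] zz'].
    by split=> //; exact: block_subspace_unbounded (bV z).
  by apply: adV => zE; apply: zz'; rewrite zE.
have WS : [set: W] #<= S.
  apply: (@injective_card_le _ _ (fun x => member P V (inr x))) => [x y /Vinj[]//|x].
  by exists (inr x).
have [w0 _] := omega1_nonempty hW.
exists S; last first.
  rewrite card_eq_le WS andbT.
  apply: card_le_trans (card_image_le _ _) _.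
  (* The two boolean tags keep the summands apart, so [nat + W] injects into W. *)
  pose k (z : nat + W) :=
    match z with inl n => h w0 (false, e n) | inr x => h x (true, 0%R) end.
  apply: (@injective_card_le _ _ k) => // -[m|x] [n|y] /hinj[xy] //.
    by move=> [/(basis_inj he) ->].
  by rewrite xy.
split=> //; last 2 first.
- move=> finS; case: hW => _ + _; apply.
  exact: finite_set_countable (card_le_finite WS finS).
- by move=> _ [z _ <-].
split=> // S' adS' [SS' nSS'].
have [X S'X nSX] : exists2 X, S' X & ~ S X.
  by apply: contrapT => no; apply: nSS' => X S'X; apply: contrapT => nSX; apply: no; exists X.
have [/(_ X S'X)[sX nbX] _] := (almost_disjointP he S').1 adS'.
have bXV z : bounded he (X `&` member P V z).
  apply: (almost_disjoint_pair he adS') => //; first by apply: SS'; exists z.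
  by move=> XE; apply: nSX; rewrite XE; exists z.
(* f codes X together with the whole sequence V. *)
pose f w := `[<exists y b v, w = h y (b, v) /\ (if b then X else V y) v>].
have fE y b v : f (h y (b, v)) <-> (if b then X else V y) v.
  split=> [/asboolP[y' [b' [v' [/hinj[-> [-> ->]]]]]]//|Xv].
  by apply/asboolP; exists y, b, v.
(* The stationary set of good guesses meets the club of closure points of h. At such an x all codes
   with index [y < x] lie below x, so the restriction of f to [below x] decodes to X and to V below
   x. *)
have [|x [xg [[x0 x0x] hx]]] := gP f _ (club_closure_points hW h _).
  by rewrite -setXTT; apply: countableX.
have codedE b y : (y < x)%O -> coded x (restr f (x := x)) b y = if b then X else V y.
  move=> yx; apply/seteqP; split=> v.
    by move=> [w [wE]]; rewrite /restr wE => /fE.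
  move=> Xv; have hyx : below x (h y (b, v)) by exact: hx.
  by exists (SigSub (mem_set hyx)); split=> //; exact/fE.
have candE : candidate x (restr f (x := x)) = X.
  apply/seteqP; split=> v; first by move=> [y [yx]]; rewrite codedE.
  by move=> Xv; exists x0; split=> //; rewrite codedE.
have famE : family x (restr f (x := x)) = earlier P rank V x.
  by apply: earlier_local => y yx; rewrite codedE.
have sA i : lsubspace (earlier P rank V x i).
  by apply: listing_subspace => //; exact: code_inj.
have [_ /(_ (restr f (x := x)))] := svalP (Phi_ex x).
rewrite candE famE => /(_ sX nbX sA) PhiX.
(* X is almost disjoint from [V x], yet infinitely many agreements of [g x] with the pairs chosen
   for X make their intersection infinite-dimensional. *)
have [_ _ /(_ X)] := VP x; apply; last exact: (bXV (inr x)).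
apply: sub_infinite_set xg => n /= <-; have [|Xn avn] := PhiX _ n; last by split.
by move=> i; apply: listing_bounded => // z z'; exact: code_inj.
Qed.
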